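(* Let $\mathsf{M}^\bullet$ be the class of all finite, weakly negative, weakly $\geq$-saturated tri-relation intuitionistic Kripke models satisfying (G1), (G2$^\bullet$), (H2), (H3) and (H4). For every $\mathbf{MT_0^-}$-formula $\phi$: $\vdash_{\mathbf{MT_0^-}}\phi$ if and only if $\mathfrak{M},w\Vdash^\bullet\phi$ for every $\mathfrak{M}\in\mathsf{M}^\bullet$ and every point $w$ of $\mathfrak{M}$.
   Context: **Language of $\mathbf{MT_0^-}$.** Fix a set $\mathrm{Prop}$ of propositional variables. Formulas: $\phi::=p\mid\bot\mid\phi\wedge\phi\mid\phi\otimes\phi\mid\phi\vee\phi\mid\phi\to\phi\mid\Box\phi\mid\Diamond\phi$. Classical formulas are the $\vee$-free ones. $\neg\phi$ abbreviates $\phi\to\bot$. **Hilbert system of $\mathbf{MT_0^-}$.** Axioms: all instances ($\phi,\psi,\chi,\theta$ arbitrary formulas, $\alpha$ classical) of 1. $\phi\to(\psi\to\phi)$; $(\phi\to(\psi\to\chi))\to((\phi\to\psi)\to(\phi\to\chi))$; $\phi\wedge\psi\to\phi$; $\phi\wedge\psi\to\psi$; $\phi\to(\chi\to(\phi\wedge\chi))$; $\phi\to\phi\vee\psi$; $\psi\to\phi\vee\psi$; $(\phi\to\chi)\to((\psi\to\chi)\to(\phi\vee\psi\to\chi))$; $\bot\to\phi$; 2. $(\alpha\to(\phi\vee\psi))\to(\alpha\to\phi)\vee(\alpha\to\psi)$; $\neg\neg\alpha\to\alpha$; 3. $\Box(\phi\to\psi)\to(\Box\phi\to\Box\psi)$;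 $\Box(\phi\to\psi)\to(\Diamond\phi\to\Diamond\psi)$; $\neg\Diamond\bot$; $\Diamond(\phi\vee\psi)\to(\Diamond\phi\vee\Diamond\psi)$; $(\Diamond\phi\to\Box\psi)\to\Box(\phi\to\psi)$; 4. $\phi\to\phi\otimes\psi$; $(\phi\to\alpha)\to((\psi\to\alpha)\to(\phi\otimes\psi\to\alpha))$; $(\phi\to\chi)\to((\psi\to\theta)\to(\phi\otimes\psi\to\chi\otimes\theta))$; $\phi\otimes\psi\to\psi\otimes\phi$; $\phi\otimes(\psi\otimes\chi)\to(\phi\otimes\psi)\otimes\chi$; $\phi\otimes(\psi\vee\chi)\to(\phi\otimes\psi)\vee(\phi\otimes\chi)$; 5. $\neg\Box\alpha\to\Diamond\neg\alpha$; $\Box(\phi\vee\psi)\to(\Box\phi\vee\Box\psi)$. Rules: Modus Ponens and Necessitation $\phi/\Box\phi$ (no uniform substitution). $\vdash_{\mathbf{MT_0^-}}\phi$ means $\phi$ is a theorem. **Tri-relation intuitionistic Kripke models.** A frame is $(W,\geq,R,S)$ with $W\ne\emptyset$, $\geq$ a partial order on $W$, $R\subseteq W\times W$, $S\subseteq W^3$ such that (F1) if $w\geq w'$ and $wRv$, then there is $v'$ with $v\geq v'$ and $w'Rv'$; (F2) if $wRv$ and $v\geq v'$, then there is $w'$ with $w\geq w'$ and $w'Rv'$; (H1) if $S(w,u,v)$ and $w\geq w'$, then there are $u',v'$ with $S(w',u',v')$, $u\geq u'$, $v\geq v'$. A model $(W,\geq,R,S,V)$ adds $V:\mathrm{Prop}\to\wp(W)$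 with: $w\in V(p)$ and $w\geq v$ imply $v\in V(p)$. A point $w$ is an $\geq$-endpoint if there is no $v\ne w$ with $w\geq v$. Satisfaction: $w\Vdash^\bullet p$ iff $w\in V(p)$; $w\Vdash^\bullet\bot$ iff $w$ is an $\geq$-endpoint; $\wedge,\vee$ pointwise as usual; $w\Vdash^\bullet\phi\to\psi$ iff for all $v$ with $w\geq v$, $v\Vdash^\bullet\phi$ implies $v\Vdash^\bullet\psi$; $w\Vdash^\bullet\phi\otimes\psi$ iff there are $v,u$ with $S(w,v,u)$, $v\Vdash^\bullet\phi$, $u\Vdash^\bullet\psi$; $w\Vdash^\bullet\Diamond\phi$ iff there is $v$ with $wRv$ and $v\Vdash^\bullet\phi$; $w\Vdash^\bullet\Box\phi$ iff $v\Vdash^\bullet\phi$ for all $u,v$ with $w\geq u$ and $uRv$. **Conditions.** Write $w>v$ for $w\geq v$, $w\neq v$. A point $w$ is $\geq$-second least if there is an $\geq$-endpoint $e$ with $w>e$, and for all $v$, $w>v$ implies that $v$ is an $\geq$-endpoint. $E^\bullet_w=\{v\mid w\geq v,\ v\text{ is }\geq\text{-second least}\}$. For $A\subseteq W$, $R(A)=\{v\mid\exists a\in A,\ aRv\}$, $R(w)=R(\{w\})$; $(\geq\circ R)(w)=\{v\mid\exists z,\ w\geq z\text{ and }zRv\}$. - Weakly $\geq$-saturated: $E_w^\bullet\neq\emptyset$ for every $w$ that is not an $\geq$-endpoint, and for every $w$ and every (possibly empty) $E\subseteq E^\bullet_w$ there is $v$ with $w\geq v$ and $E^\bullet_v=E$.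 - Weakly negative: for all $w$ and $p\in\mathrm{Prop}$, $w\Vdash^\bullet p$ iff $w\Vdash^\bullet\neg\neg p$; and $e\Vdash^\bullet p$ for all $\geq$-endpoints $e$ and all $p\in\mathrm{Prop}$. - (G1): for any $w$ and any nonempty finite $X\subseteq(\geq\circ R)(w)$ there is $u\in(\geq\circ R)(w)$ with $u\geq v$ for all $v\in X$. - (G2$^\bullet$): for any $w$ and any set $E$ of $\geq$-second least points with $E\subseteq R(E^\bullet_w)$ and $E\cap R(v)\neq\emptyset$ for every $v\in E^\bullet_w$, there is $t$ with $wRt$ and $E^\bullet_t\subseteq E$. - (H2): $S(w,u,v)$ iff $E^\bullet_w=E^\bullet_u\cup E^\bullet_v$. - (H3): for any $\geq$-endpoint $e$, $eRw$ or $wRe$ implies that $w$ is also an $\geq$-endpoint. - (H4): $eRe$ for all $\geq$-endpoints $e$. - Finite: $W$ is finite. *)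

(* Defs.v *)
From mathcomp Require Import all_boot.
From mathcomp Require Import boolp classical_sets cardinality.
From Stdlib Require Import Relation_Definitions.

Set Implicit Arguments.
Unset Strict Implicit.
Unset Printing Implicit Defensive.

Local Open Scope classical_set_scope.

(* Or is the inclusive disjunction, Tensor the split disjunction. *)
Inductive form (Var : Type) : Type :=
| Atom of Var
| Bot
| And of form Var & form Var
| Tensor of form Var & form Var
| Or of form Var & form Var
| Imp of form Var & form Var
| Box of form Var
| Dia of form Var.

Arguments Bot {Var}.

Declare Scope form_scope.
Delimit Scope form_scope with form.
Bind Scope form_scope with form.

Notation "A && B" := (And A B) : form_scope.
Notation "A ** B" := (Tensor A B) (at level 40, left associativity) : form_scope.
Notation "A || B" := (Or A B) : form_scope.
Notation "A ==> B" := (Imp A B) : form_scope.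
Notation "~~ A" := (Imp A Bot) : form_scope.

Fixpoint classical (Var : Type) (A : form Var) : bool :=
  match A with
  | Atom _ | Bot => true
  | And B C | Tensor B C | Imp B C => andb (classical B) (classical C)
  | Or _ _ => false
  | Box B | Dia B => classical B
  end.

Section HilbertSystem.
Variable Var : Type.
Implicit Types A B C D : form Var.
Local Open Scope form_scope.

Inductive axiom : form Var -> Prop :=
| ax_K A B : axiom (A ==> (B ==> A))
| ax_S A B C : axiom ((A ==> (B ==> C)) ==> ((A ==> B) ==> (A ==> C)))
| ax_andl A B : axiom ((A && B) ==> A)
| ax_andr A B : axiom ((A && B) ==> B)
| ax_and A B : axiom (A ==> (B ==> (A && B)))
| ax_orl A B : axiom (A ==> (A || B))
| ax_orr A B : axiom (B ==> (A || B))
| ax_or A B C : axiom ((A ==> C) ==> ((B ==> C) ==> ((A || B) ==> C)))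
| ax_bot A : axiom (Bot ==> A)
| ax_split A B C : classical A ->
    axiom ((A ==> (B || C)) ==> ((A ==> B) || (A ==> C)))
| ax_dne A : classical A -> axiom (~~ ~~ A ==> A)
| ax_box_imp A B : axiom (Box (A ==> B) ==> (Box A ==> Box B))
| ax_dia_imp A B : axiom (Box (A ==> B) ==> (Dia A ==> Dia B))
| ax_dia_bot : axiom (~~ (Dia Bot))
| ax_dia_or A B : axiom (Dia (A || B) ==> (Dia A || Dia B))
| ax_dia_box A B : axiom ((Dia A ==> Box B) ==> Box (A ==> B))
| ax_tensorl A B : axiom (A ==> (A ** B))
| ax_tensor_elim A B C : classical C ->
    axiom ((A ==> C) ==> ((B ==> C) ==> ((A ** B) ==> C)))
| ax_tensor_mono A B C D :
    axiom ((A ==> C) ==> ((B ==> D) ==> ((A ** B) ==> (C ** D))))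
| ax_tensorC A B : axiom ((A ** B) ==> (B ** A))
| ax_tensorA A B C : axiom ((A ** (B ** C)) ==> ((A ** B) ** C))
| ax_tensor_or A B C : axiom ((A ** (B || C)) ==> ((A ** B) || (A ** C)))
| ax_not_box A : classical A -> axiom (~~ (Box A) ==> Dia (~~ A))
| ax_box_or A B : axiom (Box (A || B) ==> (Box A || Box B)).

Inductive provable : form Var -> Prop :=
| pr_ax A : axiom A -> provable A
| pr_mp A B : provable (A ==> B) -> provable A -> provable B
| pr_nec A : provable A -> provable (Box A).

End HilbertSystem.

Record frame : Type := Frame {
  carrier :> Type;
  relge : carrier -> carrier -> Prop;
  relR : carrier -> carrier -> Prop;
  relS : carrier -> carrier -> carrier -> Prop;
  carrier_neq0 : [set: carrier] !=set0;
  ge_order : order carrier relge;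
  F1 : forall w w' v, relge w w' -> relR w v -> exists v', relge v v' /\ relR w' v';
  F2 : forall w v v', relR w v -> relge v v' -> exists w', relge w w' /\ relR w' v';
  H1 : forall w u v w', relS w u v -> relge w w' ->
         exists u' v', relS w' u' v' /\ relge u u' /\ relge v v'
}.

Record model (Var : Type) : Type := Model {
  model_frame :> frame;
  valuation : Var -> set model_frame;
  val_persistent : forall p w v, valuation p w -> relge w v -> valuation p v
}.

Section FrameNotions.
Variable W : frame.
Implicit Types (w v e : W) (A E X : set W).

Definition relgt w v : Prop := relge w v /\ w <> v.

Definition endpoint w : Prop := ~ exists v, v <> w /\ relge w v.

Definition second_least w : Prop :=
  (exists e, endpoint e /\ relgt w e) /\ forall v, relgt w v -> endpoint v.

(* The letter b in Eb, G2b and Mb stands for the superscript bullet. *)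
Definition Eb w : set W := [set v | relge w v /\ second_least v].

Definition R_img A : set W := [set v | exists a, A a /\ relR a v].

Definition geR w : set W := [set v | exists z, relge w z /\ relR z v].

Definition weakly_saturated : Prop :=
  (forall w, ~ endpoint w -> Eb w !=set0) /\
  (forall w E, E `<=` Eb w -> exists v, relge w v /\ Eb v = E).

Definition G1 : Prop :=
  forall w X, finite_set X -> X !=set0 -> X `<=` geR w ->
    exists u, geR w u /\ forall v, X v -> relge u v.

Definition G2b : Prop :=
  forall w E, E `<=` second_least -> E `<=` R_img (Eb w) ->
    (forall v, Eb w v -> E `&` R_img [set v] !=set0) ->
    exists t, relR w t /\ Eb t `<=` E.

Definition H2 : Prop :=
  forall w u v, relS w u v <-> Eb w = Eb u `|` Eb v.

Definition H3 : Prop :=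
  forall e w, endpoint e -> relR e w \/ relR w e -> endpoint w.

Definition H4 : Prop := forall e, endpoint e -> relR e e.

Definition finite_frame : Prop := finite_set [set: W].

End FrameNotions.

Fixpoint sat (Var : Type) (M : model Var) (w : M) (A : form Var) : Prop :=
  match A with
  | Atom p => valuation p w
  | Bot => endpoint w
  | And B C => sat w B /\ sat w C
  | Tensor B C => exists v u, relS w v u /\ sat v B /\ sat u C
  | Or B C => sat w B \/ sat w C
  | Imp B C => forall v, relge w v -> sat v B -> sat v C
  | Box B => forall u v, relge w u -> relR u v -> sat v B
  | Dia B => exists v, relR w v /\ sat v B
  end.

Definition weakly_negative (Var : Type) (M : model Var) : Prop :=
  (forall (w : M) (p : Var), sat w (Atom p) <-> sat w (~~ ~~ Atom p)%form) /\
  (forall (e : M) (p : Var), endpoint e -> sat e (Atom p)).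

Definition Mb (Var : Type) (M : model Var) : Prop :=
  finite_frame M /\ weakly_negative M /\ weakly_saturated M /\
  G1 M /\ G2b M /\ H2 M /\ H3 M /\ H4 M.

(* Main.v *)
(** Only the set of second-least points below a point matters for satisfaction:
    a model in the class behaves at [w] like the powerset ("team") model over
    the Kripke structure of its second-least points at the team [Eb w], and
    conversely the powerset model over a finite Kripke structure is in the
    class. This reduces both directions to team semantics, where a classical
    formula holds in a team iff it holds at each of its points.

    Every formula is provably equivalent to a disjunction of classical formulas.
    For such a disjunction D, take the finite canonical Kripke structure whose
    relevant worlds are the consistent state descriptions over the classical
    subformulas of D. If D holds at the team of all consistent worlds, then some
    disjunct holds at that team, hence at every world, hence is provable. *)

From HB Require Import structures.
From mathcomp Require Import all_boot.
From mathcomp Require Import boolp classical_sets cardinality.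
From Stdlib Require Import Relation_Definitions.
Require Import Defs.

Set Implicit Arguments.
Unset Strict Implicit.
Unset Printing Implicit Defensive.

Local Open Scope classical_set_scope.

(** * Derivations from a finite context of hypotheses *)

Section Derivability.
Variable Var : Type.
Implicit Types (A B C D : form Var) (G : seq (form Var)).
Local Open Scope form_scope.

(* [der (A :: G) B] is convertible to [der G (A ==> B)], so that the deduction
   theorem holds by conversion. *)
Fixpoint der G A : Prop := if G is B :: G' then der G' (B ==> A) else provable A.

Lemma der_provable G A : provable A -> der G A.
Proof.
elim: G A => [//|B G IH] A hA /=.
by apply: IH; apply: pr_mp hA; apply/pr_ax/ax_K.
Qed.

Lemma der_axiom G A : axiom A -> der G A.
Proof. by move=> hA; apply/der_provable/pr_ax. Qed.

(** [ax_S] distributes one hypothesis over an implication; iterating it carries modus ponens through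
    the whole context. *)
Lemma der_mp G A B : der G (A ==> B) -> der G A -> der G B.
Proof.
elim: G A B => [|C G IH] A B /=; first exact: pr_mp.
by move=> hAB; apply: (IH); apply: (IH) hAB; apply/der_axiom/ax_S.
Qed.

Lemma der_weaken G B A : der G A -> der (B :: G) A.
Proof. by apply: der_mp; apply/der_axiom/ax_K. Qed.

Lemma der_hyp G A : der (A :: G) A.
Proof.
apply: (@der_mp G (A ==> (A ==> A))); last exact/der_axiom/ax_K.
by apply: (@der_mp G (A ==> ((A ==> A) ==> A))); apply/der_axiom;
  [apply: ax_S | apply: ax_K].
Qed.

Lemma der_imp G A B : der (A :: G) B -> der G (A ==> B).
Proof. by []. Qed.

Lemma der_ax1 G A B : axiom (A ==> B) -> der G A -> der G B.
Proof. by move=> h; apply/der_mp/der_axiom. Qed.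

Lemma der_pr1 G A B : provable (A ==> B) -> der G A -> der G B.
Proof. by move=> h; apply/der_mp/der_provable. Qed.

Lemma der_and G A B : der G A -> der G B -> der G (A && B).
Proof. by move=> hA; apply: der_mp; apply: der_ax1 hA; apply: ax_and. Qed.

Lemma der_andl G A B : der G (A && B) -> der G A.
Proof. by apply/der_ax1/ax_andl. Qed.

Lemma der_andr G A B : der G (A && B) -> der G B.
Proof. by apply/der_ax1/ax_andr. Qed.

Lemma der_orl G A B : der G A -> der G (A || B).
Proof. by apply/der_ax1/ax_orl. Qed.

Lemma der_orr G A B : der G B -> der G (A || B).
Proof. by apply/der_ax1/ax_orr. Qed.

Lemma der_or_elim G A B C :
  der (A :: G) C -> der (B :: G) C -> der G (A || B) -> der G C.
Proof.
move=> hA hB; apply: der_mp; apply: der_mp (der_imp hB); apply: der_mp (der_imp hA).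
exact/der_axiom/ax_or.
Qed.

Lemma der_tensor_elim G A B C : classical C ->
  der (A :: G) C -> der (B :: G) C -> der G (A ** B) -> der G C.
Proof.
move=> cC hA hB; apply: der_mp; apply: der_mp (der_imp hB); apply: der_mp (der_imp hA).
exact/der_axiom/ax_tensor_elim.
Qed.

Lemma der_bot G A : der G Bot -> der G A.
Proof. by apply/der_ax1/ax_bot. Qed.

End Derivability.

Ltac hyp := solve [exact: der_hyp | apply: der_weaken; hyp].

(** * Monotonicity of the connectives, and equivalences that move [Or] outwards *)

Section Equivalence.
Variable Var : Type.
Implicit Types (A B C D : form Var) (G : seq (form Var)).
Local Open Scope form_scope.

Lemma provable_trans A B C :
  provable (A ==> B) -> provable (B ==> C) -> provable (A ==> C).
Proof.
move=> hAB hBC; apply: (@der_imp _ [::]).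
by apply: der_pr1 hBC _; apply: der_pr1 hAB _; hyp.
Qed.

Lemma box_mono A B : provable (A ==> B) -> provable (Box A ==> Box B).
Proof. by move=> h; apply: pr_mp (pr_nec h); apply/pr_ax/ax_box_imp. Qed.

Lemma dia_mono A B : provable (A ==> B) -> provable (Dia A ==> Dia B).
Proof. by move=> h; apply: pr_mp (pr_nec h); apply/pr_ax/ax_dia_imp. Qed.

Lemma tensor_mono A B C D : provable (A ==> C) -> provable (B ==> D) ->
  provable (A ** B ==> C ** D).
Proof.
by move=> h h'; apply: pr_mp h'; apply: pr_mp h; apply/pr_ax/ax_tensor_mono.
Qed.

Lemma and_mono A B C D : provable (A ==> C) -> provable (B ==> D) ->
  provable ((A && B) ==> (C && D)).
Proof.
move=> h h'; apply: (@der_imp _ [::]); apply: der_and.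
  by apply: der_pr1 h _; apply: der_andl; hyp.
by apply: der_pr1 h' _; apply: der_andr; hyp.
Qed.

Lemma or_mono A B C D : provable (A ==> C) -> provable (B ==> D) ->
  provable ((A || B) ==> (C || D)).
Proof.
move=> h h'; apply: (@der_imp _ [::]); apply: der_or_elim (der_hyp _ _).
  by apply: der_orl; apply: der_pr1 h _; hyp.
by apply: der_orr; apply: der_pr1 h' _; hyp.
Qed.

Lemma imp_mono A B C D : provable (C ==> A) -> provable (B ==> D) ->
  provable ((A ==> B) ==> (C ==> D)).
Proof.
move=> h h'; apply: (@der_imp _ [::]); apply: der_imp.
apply: der_pr1 h' _; apply: (@der_mp _ _ A); first by hyp.
by apply: der_pr1 h _; hyp.
Qed.

Definition eqv A B := provable (A ==> B) /\ provable (B ==> A).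

Lemma eqv_refl A : eqv A A.
Proof. by split; apply: (@der_hyp _ [::]). Qed.

Lemma eqv_trans A B C : eqv A B -> eqv B C -> eqv A C.
Proof.
by move=> [h1 h2] [h3 h4]; split; [apply: provable_trans h1 h3 | apply: provable_trans h4 h2].
Qed.

Lemma andC_eqv A B : eqv (A && B) (B && A).
Proof.
suff h C D : provable ((C && D) ==> (D && C)) by split; apply: h.
apply: (@der_imp _ [::]); apply: der_and.
  by apply: der_andr; hyp.
by apply: der_andl; hyp.
Qed.

Lemma and_or_eqv A B C : eqv (A && (B || C)) ((A && B) || (A && C)).
Proof.
split; apply: (@der_imp _ [::]).
  have: der [:: A && (B || C)] (B || C) by apply: der_andr; hyp.
  apply: der_or_elim; [apply: der_orl | apply: der_orr]; apply: der_and;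
    by [hyp | apply: (@der_andl _ _ A (B || C)); hyp].
apply: der_or_elim (der_hyp _ _); apply: der_and.
- by apply: (@der_andl _ _ A B); hyp.
- by apply: der_orl; apply: (@der_andr _ _ A B); hyp.
- by apply: (@der_andl _ _ A C); hyp.
- by apply: der_orr; apply: (@der_andr _ _ A C); hyp.
Qed.

Lemma or_provable_imp A B C : provable (A ==> C) -> provable (B ==> C) ->
  provable ((A || B) ==> C).
Proof. by move=> h h'; apply: pr_mp h'; apply: pr_mp h; apply/pr_ax/ax_or. Qed.

Lemma tensorC_eqv A B : eqv (A ** B) (B ** A).
Proof. by split; apply/pr_ax/ax_tensorC. Qed.

Lemma tensor_or_eqv A B C : eqv (A ** (B || C)) (A ** B || A ** C).
Proof.
split; first exact/pr_ax/ax_tensor_or.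
by apply: or_provable_imp; apply: tensor_mono;
  [apply: (proj1 (eqv_refl _)) | apply/pr_ax/ax_orl
  | apply: (proj1 (eqv_refl _)) | apply/pr_ax/ax_orr].
Qed.

Lemma imp_or_eqv A B C : classical A ->
  eqv (A ==> (B || C)) ((A ==> B) || (A ==> C)).
Proof.
move=> cA; split; first exact/pr_ax/ax_split.
by apply: or_provable_imp; apply: imp_mono;
  [apply: (proj1 (eqv_refl _)) | apply/pr_ax/ax_orl
  | apply: (proj1 (eqv_refl _)) | apply/pr_ax/ax_orr].
Qed.

Lemma or_imp_eqv A B C : eqv ((A || B) ==> C) ((A ==> C) && (B ==> C)).
Proof.
split; apply: (@der_imp _ [::]); last first.
  apply: der_imp; apply: der_or_elim (der_hyp _ _).
    apply: (@der_mp _ _ A); last by hyp.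
    by apply: (@der_andl _ _ _ (B ==> C)); hyp.
  apply: (@der_mp _ _ B); last by hyp.
  by apply: (@der_andr _ _ (A ==> C)); hyp.
apply: der_and; apply: der_imp; apply: (@der_mp _ _ (A || B)); try by hyp.
  by apply: der_orl; hyp.
by apply: der_orr; hyp.
Qed.

Lemma box_or_eqv A B : eqv (Box (A || B)) (Box A || Box B).
Proof.
split; first exact/pr_ax/ax_box_or.
by apply: or_provable_imp; apply: box_mono; apply/pr_ax;
  [apply: ax_orl | apply: ax_orr].
Qed.

Lemma dia_or_eqv A B : eqv (Dia (A || B)) (Dia A || Dia B).
Proof.
split; first exact/pr_ax/ax_dia_or.
by apply: or_provable_imp; apply: dia_mono; apply/pr_ax;
  [apply: ax_orl | apply: ax_orr].
Qed.

End Equivalence.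

(** * Disjunctive normal form with classical disjuncts *)

Section NormalForm.
Variable Var : Type.
Implicit Types (A B C D : form Var).
Local Open Scope form_scope.

Inductive disj : form Var -> Prop :=
| disj_classical A : classical A -> disj A
| disj_or A B : disj A -> disj B -> disj (A || B).

Definition has_nf A := exists D, disj D /\ eqv A D.

Lemma has_nf_disj D : disj D -> has_nf D.
Proof. by move=> hD; exists D; split=> //; apply: eqv_refl. Qed.

Lemma has_nf_eqv A B : eqv A B -> has_nf B -> has_nf A.
Proof. by move=> h [D [hD h']]; exists D; split=> //; apply: eqv_trans h h'. Qed.

Lemma has_nf_or A B : has_nf A -> has_nf B -> has_nf (A || B).
Proof.
move=> [D [hD [h1 h2]]] [E [hE [h3 h4]]]; exists (D || E); split.
  exact: disj_or.
by split; apply: or_mono.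
Qed.

Lemma has_nf_unary (f : form Var -> form Var) :
  (forall A, classical A -> classical (f A)) ->
  (forall A B, eqv (f (A || B)) (f A || f B)) ->
  forall D, disj D -> has_nf (f D).
Proof.
move=> cf fU D; elim=> {D} [A cA|A B _ hA _ hB].
  by apply/has_nf_disj/disj_classical/cf.
by apply: has_nf_eqv (fU A B) _; apply: has_nf_or.
Qed.

(** Commutativity up to [eqv] lets distribution in the second argument serve for the first as
    well. *)
Lemma has_nf_binary (f : form Var -> form Var -> form Var) :
  (forall A B, classical A -> classical B -> classical (f A B)) ->
  (forall A B, eqv (f A B) (f B A)) ->
  (forall A B C, eqv (f A (B || C)) (f A B || f A C)) ->
  forall D E, disj D -> disj E -> has_nf (f D E).
Proof.
move=> cf fC fU D E hD hE; elim: hD => {D} [A cA|A B _ hA _ hB].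
  by apply: has_nf_unary hE => // B cB; apply: cf.
apply: has_nf_eqv (fC _ _) _; apply: has_nf_eqv (fU _ _ _) _.
by apply: has_nf_or; apply: has_nf_eqv (fC _ _) _.
Qed.

Lemma has_nf_and A B : has_nf A -> has_nf B -> has_nf (A && B).
Proof.
move=> [D [hD [h1 h2]]] [E [hE [h3 h4]]].
apply: (@has_nf_eqv _ (D && E)); first by split; apply: and_mono.
apply: has_nf_binary hD hE => [? ? /= -> //||]; first exact: andC_eqv.
exact: and_or_eqv.
Qed.

Lemma has_nf_tensor A B : has_nf A -> has_nf B -> has_nf (A ** B).
Proof.
move=> [D [hD [h1 h2]]] [E [hE [h3 h4]]].
apply: (@has_nf_eqv _ (D ** E)); first by split; apply: tensor_mono.
apply: has_nf_binary hD hE => [? ? /= -> //||]; first exact: tensorC_eqv.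
exact: tensor_or_eqv.
Qed.

(** Implication is not symmetric, so the two sides are treated in order: a disjunctive antecedent
    turns into a conjunction of implications, and once the antecedent is classical the axiom
    [ax_split] distributes it over the consequent. *)
Lemma has_nf_imp A B : has_nf A -> has_nf B -> has_nf (A ==> B).
Proof.
move=> [D [hD [h1 h2]]] [E [hE [h3 h4]]].
apply: (@has_nf_eqv _ (D ==> E)); first by split; apply: imp_mono.
elim: hD {h1 h2} => {D} [C cC|C C' _ hC _ hC']; last first.
  by apply: has_nf_eqv (or_imp_eqv _ _ _) _; apply: has_nf_and.
elim: hE {h3 h4} => {E} [E cE|E E' _ hE _ hE'].
  by apply/has_nf_disj/disj_classical; rewrite /= cC.
by apply: has_nf_eqv (imp_or_eqv _ _ cC) _; apply: has_nf_or.
Qed.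

Lemma normal_form A : has_nf A.
Proof.
elim: A => [p||A hA B hB|A hA B hB|A hA B hB|A hA B hB|A|A].
- exact/has_nf_disj/disj_classical.
- exact/has_nf_disj/disj_classical.
- exact: has_nf_and.
- exact: has_nf_tensor.
- exact: has_nf_or.
- exact: has_nf_imp.
- move=> [D [hD [h1 h2]]]; apply: (@has_nf_eqv _ (Box D)).
    by split; apply: box_mono.
  by apply: has_nf_unary hD => // B C; apply: box_or_eqv.
- move=> [D [hD [h1 h2]]]; apply: (@has_nf_eqv _ (Dia D)).
    by split; apply: dia_mono.
  by apply: has_nf_unary hD => // B C; apply: dia_or_eqv.
Qed.

End NormalForm.

(** * The powerset model over a Kripke structure *)

Section PowersetModel.
Variables (Var X : Type) (r : X -> X -> Prop) (V : Var -> set X).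
Implicit Types (T U Z : set X) (x y : X).

(** This is the Egli-Milner lifting of [r] to sets. *)
Definition lift_rel T Z : Prop :=
  (forall y, Z y -> exists x, T x /\ r x y) /\
  (forall x, T x -> exists y, Z y /\ r x y).

(** Larger teams are higher in the order, so the empty team is the only endpoint and the singletons
    are the second-least points. *)
Definition superset T U : Prop := U `<=` T.

Lemma superset_order : order (set X) superset.
Proof.
split=> [T|T U Z hTU hUZ|T U hTU hUT]; first exact: subset_refl.
  exact: subset_trans hUZ hTU.
by apply/seteqP; split.
Qed.

Lemma lift_rel_F1 T U Z : superset T U -> lift_rel T Z ->
  exists Z', superset Z Z' /\ lift_rel U Z'.
Proof.
move=> hU [h1 h2]; exists [set y | Z y /\ exists x, U x /\ r x y].
split; first by move=> y [].
split=> [y []//|x Ux].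
have [y [Zy rxy]] := h2 x (hU x Ux).
by exists y; split=> //; split=> //; exists x.
Qed.

Lemma lift_rel_F2 T Z Z' : lift_rel T Z -> superset Z Z' ->
  exists U, superset T U /\ lift_rel U Z'.
Proof.
move=> [h1 h2] hZ; exists [set x | T x /\ exists y, Z' y /\ r x y].
split; first by move=> x [].
split=> [y Zy|x []//].
have [x [Tx rxy]] := h1 y (hZ y Zy).
by exists x; split=> //; split=> //; exists y.
Qed.

Lemma union_H1 T U U' T' : T = U `|` U' -> superset T T' ->
  exists Z Z', T' = Z `|` Z' /\ superset U Z /\ superset U' Z'.
Proof.
move=> -> hT; exists (T' `&` U), (T' `&` U'); split; last by split=> x [].
by rewrite -setIUr; apply/esym/setIidl.
Qed.

Definition powerset_frame : frame :=
  Frame (relS := fun T U Z => T = U `|` Z) (ex_intro _ set0 I) superset_order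
    lift_rel_F1 lift_rel_F2 union_H1.

Lemma subset_persistent p (T U : powerset_frame) :
  T `<=` V p -> relge T U -> U `<=` V p.
Proof. by move=> hT hU; apply: subset_trans hU hT. Qed.

Definition powerset_model : model Var := Model subset_persistent.

Lemma powerset_endpoint (T : powerset_frame) : endpoint T <-> T = set0.
Proof.
split=> [hT|-> [U [hU hs]]]; last first.
  by apply: hU; apply/seteqP; split=> // x /hs.
by apply: contrapT => hT0; apply: hT; exists set0; split; [apply: nesym | apply: sub0set].
Qed.

Lemma powerset_second_least (T : powerset_frame) :
  second_least T <-> exists x, T = [set x].
Proof.
split=> [[[_ [/powerset_endpoint -> [_ nT]]] hT]|[x ->]].
  have /set0P[x Tx] : T != set0 by apply/eqP.
  exists x; apply: contrapT => hx.
  have /powerset_endpoint : endpoint ([set x] : powerset_frame).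
    by apply: hT; split=> // y ->.
  by move/seteqP=> [/(_ x erefl)].
split.
  exists set0; split; first exact/powerset_endpoint.
  by split; [apply: sub0set | apply/eqP/set0P; exists x].
move=> U [hU nU]; apply/powerset_endpoint; apply: contrapT => /eqP/set0P[y Uy].
by apply: nU; apply/seteqP; split=> // z ->; rewrite -(hU y Uy).
Qed.

Lemma powerset_Eb (T : powerset_frame) :
  Eb T = [set U : powerset_frame | exists2 x, T x & U = [set x]].
Proof.
apply/seteqP; split=> U /=.
  by move=> [hU /powerset_second_least[x Ux]]; exists x => //; apply: hU; rewrite Ux.
by move=> [x Tx ->]; split; [move=> y -> | apply/powerset_second_least; exists x].
Qed.

Lemma powerset_Eb_sub (T U : powerset_frame) :
  Eb T `<=` Eb U -> T `<=` U.
Proof.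
rewrite !powerset_Eb => h x Tx.
have /= [|y Uy] := h [set x]; first by exists x.
by move=> /seteqP[/(_ x erefl) ->].
Qed.

Lemma powerset_Mb : finite_set [set: set X] -> Mb powerset_model.
Proof.
move=> finX; split=> //; split; last split; last split; last split; last split;
  last split.
- split=> [T p|e p /powerset_endpoint ->]; last exact: sub0set.
  split=> [hT|hT x Tx] /=.
    move=> U hU hn; apply: hn; first exact: subset_refl.
    exact: subset_trans hU hT.
  (* If [p] fails at [x], then [p] holds at no nonempty subteam of the singleton of [x]. That
     singleton therefore satisfies the negation of [p], and the double negation would make it an
     endpoint. *)
  apply: contrapT => npx.
  have /powerset_endpoint : endpoint ([set x] : powerset_frame).
    apply: (hT [set x]) => [y -> //|U hU pU].
    apply/powerset_endpoint/seteqP; split=> // y Uy.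
    by apply: npx; rewrite -(hU y Uy); apply: pU.
  by move/seteqP=> [/(_ x erefl)].
- split=> [T nT|T E hE].
    have /set0P[x Tx] : T != set0.
      by apply/eqP => T0; apply: nT; apply/powerset_endpoint.
    by rewrite powerset_Eb; exists [set x], x.
  exists [set x | E [set x]]; rewrite powerset_Eb in hE; split.
    move=> x Ex; have [y Ty] := hE _ Ex.
    by move=> /seteqP[/(_ x erefl) ->].
  rewrite powerset_Eb; apply/seteqP; split=> U /=; first by move=> [x Ex ->].
  by move=> EU; have [x Tx Ux] := hE _ EU; exists x; rewrite -?Ux.
- move=> T F _ [Z0 FZ0] hF.
  (* For (G1) the upper bound is the union of the family. It is reached from the points of [T] that
     see some member of it. *)
  exists [set y | exists2 Z, F Z & Z y]; split; last first.
    by move=> Z FZ y Zy; exists Z.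
  exists [set x | T x /\ exists Z y, [/\ F Z, Z y & r x y]].
  split; first by move=> x [].
  split=> [y [Z FZ Zy]|x [Tx [Z [y [FZ Zy rxy]]]]]; last first.
    by exists y; split=> //; exists Z.
  have [U [hU [h1 _]]] := hF _ FZ; have [x [Ux rxy]] := h1 y Zy.
  exists x; split=> //; split; first exact: hU.
  by exists Z, y.
(* For (G2b) the members of [E] are singletons, and the team of their elements is the required
   successor of [T]. *)
- move=> T E hE hR hT; exists [set y | E [set y]]; split; last first.
    by rewrite powerset_Eb => _ [y Ey ->].
  rewrite powerset_Eb in hR hT; split=> [y Ey|x Tx].
    have [_ [[x Tx ->] [h _]]] := hR _ Ey.
    by have [_ [-> rxy]] := h y erefl; exists x.
  have [|U [EU [_ [/= -> [_ h]]]]] := hT [set x]; first by exists x.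
  have [y [Uy rxy]] := h x erefl; exists y; split=> //=.
  have [z Uz] := (powerset_second_least _).1 (hE _ EU).
  by move: EU Uy; rewrite Uz => + ->.
- move=> T U Z; split=> [->|h].
    rewrite !powerset_Eb; apply/seteqP; split=> Y /=.
      by move=> [x [Ux|Zx] ->]; [left | right]; exists x.
    by move=> [] [x hx ->]; exists x => //; [left | right].
  apply/seteqP; split=> [x Tx|].
    have : (Eb U `|` Eb Z) [set x].
      by rewrite -h powerset_Eb; exists x.
    rewrite !powerset_Eb => -[] [y hy] /seteqP[/(_ x erefl) ->] _;
      by [left | right].
  by rewrite subUset; split; apply: powerset_Eb_sub; rewrite h;
    [apply: subsetUl | apply: subsetUr].
- move=> e T /powerset_endpoint -> h; apply/powerset_endpoint/seteqP.
  split=> // x Tx; case: h => -[h1 h2].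
    by have [y [[]]] := h1 x Tx.
  by have [y [[]]] := h2 x Tx.
- by move=> e /powerset_endpoint ->; split.
Qed.

End PowersetModel.

(** * Persistence of satisfaction along the order, in any model *)

Section Persistence.
Variable Var : Type.
Implicit Types (M : model Var) (A : form Var).

Lemma endpoint_persistent (W : frame) (w v : W) :
  relge w v -> endpoint w -> endpoint v.
Proof.
move=> wv ew; suff -> : v = w by [].
by apply: contrapT => nvw; apply: ew; exists v.
Qed.

(** The clauses for [Imp] and [Box] quantify over all lower points, so transitivity suffices there;
    [Tensor] uses (H1) and [Dia] uses (F1). *)
Lemma sat_persistent M A (w v : M) : relge w v -> sat w A -> sat v A.
Proof.
have [_ trans _] := ge_order M.
elim: A w v => [p||A IHA B IHB|A IHA B IHB|A IHA B IHB|A IHA B IHB|A IHA|A IHA]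
  w v wv /=.
- by move=> pw; apply: val_persistent pw wv.
- exact: endpoint_persistent.
- by move=> [hA hB]; split; [apply: IHA wv hA | apply: IHB wv hB].
- move=> [u [u' [hS [hA hB]]]].
  have [z [z' [hS' [uz uz']]]] := H1 hS wv.
  by exists z, z'; split=> //; split; [apply: IHA uz hA | apply: IHB uz' hB].
- by move=> [hA|hB]; [left; apply: IHA wv hA | right; apply: IHB wv hB].
- by move=> h u vu; apply: h; apply: trans wv vu.
- by move=> h u z vu; apply: h; apply: trans wv vu.
- move=> [t [wt hA]]; have [t' [tt' vt']] := F1 wv wt.
  by exists t'; split=> //; apply: IHA tt' hA.
Qed.

End Persistence.

(** * Team semantics: flatness of classical formulas, and soundness *)

Section TeamSemantics.
Variables (Var X : Type) (r : X -> X -> Prop) (V : Var -> set X).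
Notation K := (powerset_model r V).
Implicit Types (A B C : form Var) (T U Z : K) (x y : X).

(** At a single point the split disjunction collapses to Boolean disjunction. *)
Fixpoint ksat x A : Prop :=
  match A with
  | Atom p => V p x
  | Bot => False
  | And B C => ksat x B /\ ksat x C
  | Tensor B C | Or B C => ksat x B \/ ksat x C
  | Imp B C => ksat x B -> ksat x C
  | Box B => forall y, r x y -> ksat y B
  | Dia B => exists y, r x y /\ ksat y B
  end.

Lemma sat_subset T U A : U `<=` T -> sat T A -> sat U A.
Proof. by move=> UT; apply: (@sat_persistent _ K A T U). Qed.

Lemma sat_set0 A : sat (set0 : K) A.
Proof.
elim: A => [p||A IHA B IHB|A IHA B IHB|A IHA B IHB|A IHA B IHB|A IHA|A IHA] /=.
- exact: sub0set.
- exact/powerset_endpoint.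
- by split.
- by exists set0, set0; rewrite setU0.
- by left.
- by move=> U; rewrite /relge /= /superset subset0 => ->.
- move=> U Z; rewrite /relge /= /superset subset0 => -> [h _].
  suff -> : Z = set0 by [].
  by apply/seteqP; split=> // y /h [x []].
- by exists set0; split=> //; split.
Qed.

(** This is flatness. Pointwise truth yields the witnessing teams by comprehension: the points
    satisfying each side for [Tensor], all good successors for [Dia]. The converse tests singletons
    for [Imp] and [Box]. *)
Lemma sat_classical A T : classical A -> sat T A <-> forall x, T x -> ksat x A.
Proof.
elim: A T => [p||A IHA B IHB|A IHA B IHB|//|A IHA B IHB|A IHA|A IHA] T.
- by [].
- move=> _; rewrite /= powerset_endpoint; split=> [-> //|h].
  by apply/seteqP; split.
- move=> /= /andP[cA cB]; rewrite IHA // IHB //.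
  split=> [[hA hB] x Tx|h]; first by split; [apply: hA | apply: hB].
  by split=> x /h [].
- move=> /= /andP[cA cB]; split=> [[U [U' [-> [hU hU']]]] x|h].
    by move=> [|] hx; [left; apply: (IHA U cA).1 hU _ hx
                     | right; apply: (IHB U' cB).1 hU' _ hx].
  exists [set x | T x /\ ksat x A], [set x | T x /\ ksat x B]; split.
    apply/seteqP; split=> x; last by move=> [] [].
    by move=> Tx; case: (h x Tx) => hx; [left | right].
  by split; [apply/IHA | apply/IHB] => // x [].
- move=> /= /andP[cA cB]; split=> [h x Tx hA|h U hU /(IHA _ cA) hA].
    apply: (IHB [set x] cB).1 => //.
    by apply: h => [y -> //|]; apply/IHA => // y ->.
  by apply/IHB => // x Ux; apply: h (hA x Ux); apply: hU.
- move=> /= cA; split=> [h x Tx y rxy|h U Z hU [hZ _]].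
    apply: (IHA [set y] cA).1 => //; apply: (h [set x]) => [z -> //|].
    by split=> z ->; [exists x | exists y].
  apply/IHA => // y /hZ [x [Ux rxy]]; apply: h rxy; exact: hU.
- move=> /= cA; split=> [[Z [[_ hZ] /(IHA _ cA) hA]] x Tx|h].
    by have [y [Zy rxy]] := hZ x Tx; exists y; split=> //; apply: hA.
  exists [set y | ksat y A /\ exists x, T x /\ r x y]; split.
    split=> [y []//|x Tx]; have [y [rxy hy]] := h x Tx.
    by exists y; split=> //; split=> //; exists x.
  by apply/IHA => // y [].
Qed.


Definition img T : K := [set y | exists x, T x /\ r x y].

(* [img T] is the largest team reachable from a subteam of [T]. *)
Lemma sat_box A T : sat T (Box A) <-> sat (img T) A.
Proof.
split=> [h|h U Z hU [hZ _]]; last first.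
  apply: sat_subset h => y /hZ [x [Ux rxy]].
  by exists x; split=> //; apply: hU.
(* Dead ends are removed because [lift_rel] asks every point of the source team for a successor. *)
apply: (h [set x | T x /\ exists y, r x y]); first by move=> x [].
split=> [y [x [Tx rxy]]|x [Tx [y rxy]]].
  by exists x; split=> //; split=> //; exists y.
by exists y; split=> //; exists x.
Qed.

Lemma axiom_sound A : axiom A -> forall T, sat T A.
Proof.
have refl T : T `<=` T by apply: subset_refl.
case=> {A} /=.
- by move=> A B T U _ hA U' hU _; apply: sat_subset hU hA.
- move=> A B C T U _ h U' hU h' Z hZ hA.
  apply: (h Z _ hA Z) => //; first exact: subset_trans hZ hU.
  exact: h'.
- by move=> A B T U _ [].
- by move=> A B T U _ [].
- by move=> A B T U _ hA U' hU hB; split=> //; apply: sat_subset hU hA.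
- by move=> A B T U _; left.
- by move=> A B T U _; right.
- move=> A B C T U _ h U' hU h' Z hZ [hA|hB]; last exact: h'.
  by apply: h => //; apply: subset_trans hZ hU.
- by move=> A T U _ /powerset_endpoint ->; apply: sat_set0.
- move=> A B C cA T U _ h.
  (* By flatness there is a largest subteam of [U] satisfying the classical [A]. Whichever disjunct
     holds there passes to all subteams of [U] that satisfy [A]. *)
  have hA : sat ([set x | U x /\ ksat x A] : K) A.
    by apply/sat_classical => // x [].
  have sub Z : Z `<=` U -> sat Z A -> Z `<=` [set x | U x /\ ksat x A].
    by move=> hZ /sat_classical hZA x Zx; split; [apply: hZ | apply: hZA].
  have [|hB|hC] := h _ _ hA; first by move=> x [].
    by left=> Z hZ hZA; apply: sat_subset (sub _ hZ hZA) hB.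
  by right=> Z hZ hZA; apply: sat_subset (sub _ hZ hZA) hC.
- move=> A cA T U _ h; apply/sat_classical => // x Ux.
  apply: contrapT => nA.
  have /powerset_endpoint/seteqP[/(_ x erefl) //] : endpoint ([set x] : K).
  apply: h => [y -> //|Z hZ /sat_classical hA].
  apply/powerset_endpoint/seteqP; split=> // y Zy.
  by apply: nA; rewrite -(hZ y Zy); apply: hA.
- move=> A B T U _ h U' hU h' Z Z' hZ hr.
  apply: (h Z Z' _ hr Z') => //; first exact: subset_trans hZ hU.
  exact: (h' Z).
- move=> A B T U _ h U' hU [Z [hr hA]].
  by exists Z; split=> //; apply: (h U' Z _ hr Z).
- move=> T U _ [Z [[_ hr] /powerset_endpoint Z0]].
  apply/powerset_endpoint/seteqP; split=> // x Ux.
  by have [y []] := hr x Ux; rewrite Z0.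
- by move=> A B T U _ [Z [hr [hA|hB]]]; [left | right]; exists Z.
- move=> A B T U _ h U' Z hU hr Z' hZ' hA.
  (* The premise has to be used at a team related to [Z'] itself: at [W], the team [Z'] witnesses
     [Dia A], and the resulting [Box B] gives [B] at [Z']. *)
  have [W [hW hr']] := lift_rel_F2 hr hZ'.
  apply: (h W _ _ W Z') => //; first exact: subset_trans hW hU.
  by exists Z'.
- move=> A B T U _ hA; exists U, set0; rewrite setU0.
  by split=> //; split=> //; apply: sat_set0.
- move=> A B C cC T U _ h U' hU h' W hW [Z [Z' [eW [hA hB]]]].
  have /sat_classical hZ : sat (Z : K) C.
    by apply: h => //; apply: subset_trans hU; apply: subset_trans hW;
      rewrite eW; apply: subsetUl.
  have /sat_classical hZ' : sat (Z' : K) C.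
    by apply: h' => //; apply: subset_trans hW; rewrite eW; apply: subsetUr.
  by apply/sat_classical => //; rewrite eW => x [Zx|Zx]; [apply: hZ | apply: hZ'].
- move=> A B C D T U _ h U' hU h' W hW [Z [Z' [eW [hA hB]]]].
  exists Z, Z'; split=> //; split; [apply: h | apply: h'] => //.
    by apply: subset_trans hU; apply: subset_trans hW; rewrite eW; apply: subsetUl.
  by apply: subset_trans hW; rewrite eW; apply: subsetUr.
- move=> A B T U _ [Z [Z' [-> [hA hB]]]].
  by exists Z', Z; rewrite setUC.
- move=> A B C T U _ [Z [Z' [-> [hA [W [W' [-> [hB hC]]]]]]]].
  exists (Z `|` W), W'; rewrite setUA; split=> //; split=> //.
  by exists Z, W.
- move=> A B C T U _ [Z [Z' [-> [hA [hB|hC]]]]]; [left | right];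
    by exists Z, Z'.
- move=> A cA T U _ h.
  (* The witness consists of all successors of [U] that refute [A]. A point of [U] without such a
     successor would give a singleton satisfying [Box A], which the premise forces to be an
     endpoint. *)
  exists [set y | ~ ksat y A /\ exists x, U x /\ r x y]; split; last first.
    move=> Z hZ /sat_classical hA; apply/powerset_endpoint/seteqP.
    split=> // y Zy; have [nA _] := hZ y Zy.
    by apply: nA; apply: hA.
  split=> [y []//|x Ux]; apply: contrapT => nx.
  have /powerset_endpoint/seteqP[/(_ x erefl) //] : endpoint ([set x] : K).
  apply: h => [y -> //|]; apply/(@sat_classical (Box A) [set x] cA).
  move=> _ -> y rxy; apply: contrapT => nA.
  by apply: nx; exists y; split=> //; split=> //; exists x.
(* A boxed formula is tested at the single team [img U], so one disjunct is chosen there once and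
   for all. *)
- move=> A B T U _ /(@sat_box (A || B)%form U)[hA|hB].
    by left; apply/(@sat_box A U).
  by right; apply/(@sat_box B U).
Qed.

Lemma provable_sound A : provable A -> forall T, sat T A.
Proof.
elim=> {A} [A|A B _ hAB _ hA|A _ hA] T; first exact: axiom_sound.
  exact: (hAB T T (@subset_refl _ T) (hA T)).
by move=> U Z _ _; apply: hA.
Qed.

End TeamSemantics.

(** * From a model of the class to teams of second-least points *)

Section Bridge.
Variables (Var : Type) (M : model Var).
Hypothesis MbM : Mb M.
Implicit Types (w v u t x y : M) (A : form Var).

Let weak_neg : weakly_negative M. Proof. by case: MbM => _ []. Qed.
Let saturated : weakly_saturated M. Proof. by case: MbM => _ [_ []]. Qed.
Let finM : finite_frame M. Proof. by case: MbM. Qed.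
Let g1 : G1 M. Proof. by case: MbM => _ [_ [_ []]]. Qed.
Let g2 : G2b M. Proof. by case: MbM => _ [_ [_ [_ []]]]. Qed.
Let h2 : H2 M. Proof. by case: MbM => _ [_ [_ [_ [_ []]]]]. Qed.
Let h3 : H3 M. Proof. by case: MbM => _ [_ [_ [_ [_ [_ []]]]]]. Qed.

Let ge_refl w : relge w w.
Proof. by have [h _ _] := ge_order M; apply: h. Qed.

Let ge_trans u w v : relge w u -> relge u v -> relge w v.
Proof. by have [_ h _] := ge_order M; apply: h. Qed.

(** Restricting the target keeps the successors of a team among the second-least points, so the
    whole carrier can serve as the set of worlds. *)
Definition atom_rel x y : Prop := relR x y /\ second_least y.

Notation K := (powerset_model atom_rel (@valuation _ M)).

Lemma Eb_subset w v : relge w v -> Eb v `<=` Eb w.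
Proof. by move=> wv x [vx sx]; split=> //; apply: ge_trans vx. Qed.

Lemma second_least_nonendpoint x : second_least x -> ~ endpoint x.
Proof.
by move=> [[e [_ [xe nxe]]] _]; apply; exists e; split=> //; apply: nesym.
Qed.

Lemma second_least_ge x v : second_least x -> relge x v -> ~ endpoint v -> v = x.
Proof.
move=> [_ h] xv nv; apply: contrapT => nvx; apply: nv; apply: h.
by split=> //; apply: nesym.
Qed.

Lemma endpoint_Eb w : endpoint w <-> Eb w = set0.
Proof.
split=> [ew|w0].
  apply/seteqP; split=> // x [wx sx].
  by apply: (second_least_nonendpoint sx); apply: endpoint_persistent wx ew.
by apply: contrapT => /(proj1 saturated) [x]; rewrite w0.
Qed.

(** Weak negativity reduces [p] to its double negation. If a point below [w] satisfies the negation
    of [p] and is no endpoint, saturation puts a second-least point below it, where [p] holds and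
    forces an endpoint. *)
Lemma valuation_Eb p w : valuation p w <-> Eb w `<=` valuation p.
Proof.
split=> [pw x [wx _]|h]; first exact: val_persistent pw wx.
apply/(weak_neg.1 w p) => v wv nv; apply: contrapT => ev.
have [x [vx sx]] := saturated.1 v ev.
apply: (second_least_nonendpoint sx); apply: nv => //.
by apply: h; split=> //; apply: ge_trans vx.
Qed.

(** A second-least [y] below [t] is pulled back by (F2) and its source lowered to a second-least
    [x]; (F1) then sends [x] to a point below [y]. By (H3) no endpoint occurs on the way, so that
    point is [y]. The other half exchanges (F1) and (F2). *)
Lemma relR_Eb w t : relR w t -> lift_rel atom_rel (Eb w) (Eb t).
Proof.
move=> wt; split=> [y [ty sy]|x [wx sx]].
  have [w' [ww' w'y]] := F2 wt ty.
  have nw' : ~ endpoint w'.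
    by move=> ew'; apply: (second_least_nonendpoint sy); apply: (h3 ew'); left.
  have [x [w'x sx]] := saturated.1 w' nw'.
  have [y' [yy' xy']] := F1 w'x w'y.
  have ny' : ~ endpoint y'.
    by move=> ey'; apply: (second_least_nonendpoint sx); apply: (h3 ey'); right.
  exists x; rewrite -(second_least_ge sy yy' ny').
  split; first by split=> //; apply: ge_trans w'x.
  by split=> //; rewrite (second_least_ge sy yy' ny').
have [t' [tt' xt']] := F1 wx wt.
have nt' : ~ endpoint t'.
  by move=> et'; apply: (second_least_nonendpoint sx); apply: (h3 et'); right.
have [y [t'y sy]] := saturated.1 t' nt'.
have [x' [xx' x'y]] := F2 xt' t'y.
have nx' : ~ endpoint x'.
  by move=> ex'; apply: (second_least_nonendpoint sy); apply: (h3 ex'); left.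
rewrite (second_least_ge sx xx' nx') in x'y.
by exists y; split; split=> //; apply: ge_trans t'y.
Qed.

Lemma sat_Eb A w : sat w A <-> sat (Eb w : K) A.
Proof.
elim: A w => [p||A IHA B IHB|A IHA B IHB|A IHA B IHB|A IHA B IHB|A IHA|A IHA] w.
- exact: valuation_Eb.
- by split=> [/endpoint_Eb ew|/powerset_endpoint ew];
    [apply/powerset_endpoint | apply/endpoint_Eb].
- by split=> -[/IHA hA /IHB hB].
- split=> [[v [u [/h2 wvu [/IHA hA /IHB hB]]]]|[T [U [wTU [hA hB]]]]].
    by exists (Eb v), (Eb u).
  (* Saturation realises both halves of the split as points, and (H2) relates them to [w]. *)
  have [|v [_ vT]] := saturated.2 w T; first by rewrite wTU; apply: subsetUl.
  have [|u [_ uU]] := saturated.2 w U; first by rewrite wTU; apply: subsetUr.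
  exists v, u; split; first by apply/h2; rewrite vT uU.
  by split; [apply/IHA; rewrite vT | apply/IHB; rewrite uU].
- by split=> -[/IHA hA|/IHB hB]; [left | right | left | right].
- split=> [h T wT|h v wv /IHA hA].
    have [v [wv <-]] := saturated.2 w T wT.
    by move=> /IHA hA; apply/IHB/h.
  by apply/IHB; apply: h hA; apply: Eb_subset.
- split=> [h T Z wT [hZ _]|h u v wu uv]; last first.
    by apply/IHA; exact: (h (Eb u) (Eb v) (Eb_subset wu) (relR_Eb uv)).
  have [->|/eqP/set0P Z0] := pselect (Z = set0); first exact: sat_set0.
  have geZ : Z `<=` geR w.
    by move=> y /hZ [x [/wT [wx _] [xy _]]]; exists x.
  (* (G1) bounds the finite team [Z] by one reachable point [t], and saturation then finds a point
     below [t] whose team is exactly [Z]. *)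
  have [t [[z [wz zt]] tZ]] := g1 (sub_finite_set (@subsetT _ Z) finM) Z0 geZ.
  have [|v [tv vZ]] := saturated.2 t Z.
    by move=> y Zy; split; [apply: tZ | have [x [_ [_]]] := hZ y Zy].
  by rewrite -vZ; apply/IHA; apply: sat_persistent tv _; apply: h wz zt.
- split=> [[t [wt /IHA hA]]|[Z [[h1 h2'] hA]]].
    by exists (Eb t); split=> //; apply: relR_Eb.
  (* (G2b) gives only a successor whose team lies inside [Z]; downward closure makes this enough. *)
  have [|||t [wt tZ]] := @g2 w Z.
  + by move=> y /h1 [x [_ []]].
  + by move=> y /h1 [x [wx [xy _]]]; exists x.
  + by move=> x /h2' [y [Zy [xy _]]]; exists y; split=> //; exists x.
  by exists t; split=> //; apply/IHA; apply: sat_subset tZ hA.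
Qed.

End Bridge.

(** Equality of formulas is decided classically, as [Var] is arbitrary; membership in lists of
    formulas relies on it. *)
HB.instance Definition _ (Var : Type) := gen_eqMixin (form Var).
HB.instance Definition _ (Var : Type) := gen_choiceMixin (form Var).

(** * The canonical structure over a finite list of classical formulas *)

Section Canonical.
Variable Var : Type.
Implicit Types (A B C : form Var) (S : seq (form Var)).
Local Open Scope form_scope.

(** [~~ Bot] stands for the empty conjunction. *)
Definition state_descriptions S : seq (form Var) :=
  foldr (fun A l => [seq A && g | g <- l] ++ [seq ~~ A && g | g <- l])
    [:: ~~ Bot] S.

Lemma state_descriptions_decide S g A :
  g \in state_descriptions S -> A \in S ->
  provable (g ==> A) \/ provable (g ==> ~~ A).
Proof.
elim: S g => [//|B S IH] g /=; rewrite mem_cat inE.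
move=> /orP[] /mapP[g' hg' ->] /orP[/eqP->|AS].
- by left; apply/pr_ax/ax_andl.
- by have [h|h] := IH _ hg' AS; [left | right];
    apply: provable_trans h; apply/pr_ax/ax_andr.
- by right; apply/pr_ax/ax_andl.
- by have [h|h] := IH _ hg' AS; [left | right];
    apply: provable_trans h; apply/pr_ax/ax_andr.
Qed.

(* Instantiated with [P := provable] and with [P B := provable (g ==> Box B)]:
   the state descriptions exhaust all cases, also below a box. *)
Lemma state_descriptions_exhaust (P : form Var -> Prop) S B :
  (forall A C, provable (A ==> C) -> P A -> P C) ->
  (forall A C, P A -> P C -> P (A && C)) ->
  classical B -> all (@classical Var) S ->
  (forall g, g \in state_descriptions S -> P (g ==> B)) -> P B.
Proof.
move=> Pmono Pand; elim: S B => [|A S IH] B cB /=.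
  move=> _ h; apply: Pmono (h (~~ Bot) _); last by rewrite inE.
  apply: (@der_imp _ [::]); apply: (@der_mp _ _ (~~ Bot)); first by hyp.
  exact/der_imp/der_hyp.
move=> /andP[cA cS] h.
(* The head [A] moves from the description into the goal, once positively and once negated, so the
   induction must generalise [B]. The two cases are merged by double negation elimination for the
   classical [B]. *)
have hpos : P (A ==> B).
  apply: IH => //=; first by rewrite cA.
  move=> g hg; apply: Pmono (h (A && g) _); last first.
    by rewrite mem_cat map_f.
  apply: (@der_imp _ [::]); do 2 apply: der_imp.
  by apply: (@der_mp _ _ (A && g)); [hyp | apply: der_and; hyp].
have hneg : P (~~ A ==> B).
  apply: IH => //=; first by rewrite cA.
  move=> g hg; apply: Pmono (h (~~ A && g) _); last first.
    by rewrite mem_cat (map_f _ hg) orbT.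
  apply: (@der_imp _ [::]); do 2 apply: der_imp.
  by apply: (@der_mp _ _ (~~ A && g)); [hyp | apply: der_and; hyp].
apply: Pmono (Pand _ _ hpos hneg).
apply: (@der_imp _ [::]); apply: (@der_ax1 _ _ (~~ ~~ B)); first exact: ax_dne.
apply: der_imp; apply: (@der_mp _ _ B); first by hyp.
apply: (@der_mp _ _ (~~ A)); first by apply: (@der_andr _ _ (A ==> B)); hyp.
apply: der_imp; apply: (@der_mp _ _ B); first by hyp.
apply: (@der_mp _ _ A); last by hyp.
by apply: (@der_andl _ _ _ (~~ A ==> B)); hyp.
Qed.

Fixpoint subformulas A : seq (form Var) :=
  A :: match A with
  | Atom _ | Bot => [::]
  | And B C | Tensor B C | Or B C | Imp B C => subformulas B ++ subformulas C
  | Box B | Dia B => subformulas B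
  end.

Lemma subformulas_refl A : A \in subformulas A.
Proof. by case: A => *; rewrite inE eqxx. Qed.

Lemma classical_subformulas A :
  classical A -> all (@classical Var) (subformulas A).
Proof.
by elim: A => [p||A IHA B IHB|A IHA B IHB|//|A IHA B IHB|A IHA|A IHA] //= h;
  rewrite h ?all_cat //=; (try by apply: IHA); move/andP: h => [hA hB];
  rewrite IHA ?IHB.
Qed.

Variable S : seq (form Var).
Hypothesis S_classical : all (@classical Var) S.

Definition world : Type := seq_sub (state_descriptions S).

Implicit Types g d : world.

(* Inconsistent state descriptions are kept as worlds; they are never reached by
   [canonical_rel] and are left out of the team [consistent]. *)
Definition consistent g : Prop := ~ provable (~~ val g).

(** [d] is a successor as soon as [g] does not exclude it. *)
Definition canonical_rel g d : Prop := ~ provable (val g ==> Box (~~ val d)).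

Definition canonical_val (p : Var) : set world :=
  [set g | provable (val g ==> Atom p)].

Lemma canonical_rel_consistent g d : canonical_rel g d -> consistent d.
Proof.
move=> gd hd; apply: gd; apply: (@der_imp _ [::]); apply: der_provable.
exact: pr_nec.
Qed.

Lemma consistent_contra g A : consistent g ->
  provable (val g ==> A) -> provable (val g ==> ~~ A) -> False.
Proof.
move=> cg h h'; apply: cg; apply: (@der_imp _ [::]).
by apply: (@der_mp _ _ A); [apply: der_pr1 h' _ | apply: der_pr1 h _]; hyp.
Qed.

Lemma decide g A : A \in S ->
  provable (val g ==> A) \/ provable (val g ==> ~~ A).
Proof. exact: state_descriptions_decide (valP g). Qed.

Lemma box_exhaust g B : classical B ->
  (forall d, provable (val g ==> Box (val d ==> B))) -> provable (val g ==> Box B).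
Proof.
move=> cB h.
apply: (@state_descriptions_exhaust (fun C => provable (val g ==> Box C)) S) => //.
- by move=> A C hAC hA; apply: provable_trans hA (box_mono hAC).
- move=> A C hA hC; apply: (@der_imp _ [::]).
  apply: (@der_mp _ _ (Box C)); last by apply: der_pr1 hC _; hyp.
  apply: (@der_ax1 _ _ (Box (C ==> (A && C)))); first exact: ax_box_imp.
  apply: (@der_pr1 _ _ (Box A)); first exact/box_mono/pr_ax/ax_and.
  by apply: der_pr1 hA _; hyp.
- by move=> d hd; apply: (h (SeqSub hd)).
Qed.

(** The truth lemma. [Box] and [Dia] are primitive and are handled separately; each member of [S] is
    decided by every world. *)
Lemma truth A g : classical A -> {subset subformulas A <= S} -> consistent g ->
  ksat canonical_rel canonical_val g A <-> provable (val g ==> A).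
Proof.
have sub_l B C D : {subset D :: subformulas B ++ subformulas C <= S} ->
    {subset subformulas B <= S}.
  by move=> h E hE; apply: h; rewrite inE mem_cat hE orbT.
have sub_r B C D : {subset D :: subformulas B ++ subformulas C <= S} ->
    {subset subformulas C <= S}.
  by move=> h E hE; apply: h; rewrite inE mem_cat hE !orbT.
have sub_1 B D : {subset D :: subformulas B <= S} -> {subset subformulas B <= S}.
  by move=> h E hE; apply: h; rewrite inE hE orbT.
have self B : {subset subformulas B <= S} -> B \in S.
  by apply; apply: subformulas_refl.
(* Tensor elimination applies because its goal [Bot] is classical. *)
have neg_tensor B C : provable (~~ B ==> (~~ C ==> ~~ (B ** C))).
  apply: (@der_imp _ [::]); do 2 apply: der_imp.
  apply: der_tensor_elim (der_hyp _ _) => //.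
    by apply: (@der_mp _ _ B); hyp.
  by apply: (@der_mp _ _ C); hyp.
elim: A g => [p||A IHA B IHB|A IHA B IHB|//|A IHA B IHB|A IHA|A IHA] g /=.
- by [].
- by move=> _ _ cg; split.
- move=> /andP[cA cB] hS cg; rewrite IHA ?IHB //; try by [apply: sub_l hS | apply: sub_r hS].
  split=> [[hA hB]|h].
    by apply: (@der_imp _ [::]); apply: der_and; [apply: der_pr1 hA _ | apply: der_pr1 hB _]; hyp.
  by split; apply: provable_trans h _; apply/pr_ax; [apply: ax_andl | apply: ax_andr].
- move=> /andP[cA cB] hS cg; have [hSA hSB] := (sub_l _ _ _ hS, sub_r _ _ _ hS).
  rewrite IHA ?IHB //; split=> [[h|h]|h].
  + by apply: provable_trans h _; apply/pr_ax/ax_tensorl.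
  + apply: provable_trans h _; apply: (@provable_trans _ _ (B ** A)); apply/pr_ax.
      exact: ax_tensorl.
    exact: ax_tensorC.
  + have [|nA] := decide g (self _ hSA); first by left.
    have [|nB] := decide g (self _ hSB); first by right.
    exfalso; apply: (consistent_contra cg h); apply: (@der_imp _ [::]).
    apply: (@der_mp _ _ (~~ B)); last by apply: der_pr1 nB _; hyp.
    by apply: (der_pr1 (neg_tensor A B)); apply: der_pr1 nA _; hyp.
- move=> /andP[cA cB] hS cg; have [hSA hSB] := (sub_l _ _ _ hS, sub_r _ _ _ hS).
  rewrite IHA ?IHB //; split=> [h|h hA]; last first.
    apply: (@der_imp _ [::]); apply: (@der_mp _ _ A).
      by apply: der_pr1 h _; hyp.
    by apply: der_pr1 hA _; hyp.
  apply: (@der_imp _ [::]); apply: der_imp.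
  have [/h hB|nA] := decide g (self _ hSA); first by apply: der_pr1 hB _; hyp.
  apply: der_bot; apply: (@der_mp _ _ A); last by hyp.
  by apply: der_pr1 nA _; hyp.
- move=> cA hS cg; have hSA := sub_1 _ _ hS; split=> [h|h d gd].
    (* At a successor the induction hypothesis gives a theorem to necessitate; at any other world,
       [g] proves the box of its negation, and the implication holds by explosion. *)
    apply: box_exhaust => // d; have [gd|/contrapT ngd] := pselect (canonical_rel g d).
      apply: (@der_imp _ [::]); apply/der_provable/pr_nec.
      by apply/IHA => //; [apply: canonical_rel_consistent gd | apply: h].
    apply: provable_trans ngd _; apply: box_mono; apply: imp_mono.
      exact: (proj1 (eqv_refl _)).
    exact/pr_ax/ax_bot.
  apply/IHA => //; first exact: canonical_rel_consistent gd.
  have [//|nA] := decide d (self _ hSA); exfalso; apply: gd.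
  apply: provable_trans h _; apply: box_mono; apply: (@der_imp _ [::]).
  apply: der_imp; apply: (@der_mp _ _ A); last by hyp.
  by apply: der_pr1 nA _; hyp.
- move=> cA hS cg; have hSA := sub_1 _ _ hS; split=> [[d [gd hd]]|h].
    have cd := canonical_rel_consistent gd.
    have {}hd : provable (val d ==> A) by apply/IHA.
    have [//|nA] := decide g (hS _ (mem_head _ _)); exfalso; apply: gd.
    apply: (@provable_trans _ _ (Box (~~ A))); last first.
      by apply: box_mono; apply: imp_mono => //; exact: (proj1 (eqv_refl _)).
    apply: (@der_imp _ [::]); apply: der_ax1; first exact: ax_dia_box.
    apply: der_imp; apply: der_bot; apply: (@der_mp _ _ (Dia A)); last by hyp.
    by apply: der_pr1 nA _; hyp.
  apply: contrapT => nd; apply: (consistent_contra cg h).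
  (* If no successor satisfies [A], all of them decide it negatively, so [g] proves [Box (~~ A)].
     With [Dia A] this gives [Dia Bot], which [ax_dia_bot] refutes. *)
  have hbox : provable (val g ==> Box (~~ A)).
    apply: box_exhaust; first by rewrite /= cA.
    move=> d; have [gd|/contrapT ngd] := pselect (canonical_rel g d).
      apply: (@der_imp _ [::]); apply/der_provable/pr_nec.
      have [hA|//] := decide d (self _ hSA); exfalso; apply: nd; exists d.
      by split=> //; apply/IHA => //; apply: canonical_rel_consistent gd.
    apply: provable_trans ngd _; apply: box_mono; apply: imp_mono.
      exact: (proj1 (eqv_refl _)).
    exact/pr_ax/ax_bot.
  apply: (@der_imp _ [::]); apply: der_imp.
  apply: (@der_mp _ _ (Dia Bot)); first exact/der_axiom/ax_dia_bot.
  apply: (@der_mp _ _ (Dia A)); last by hyp.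
  apply: (@der_ax1 _ _ (Box (~~ A))); first exact: ax_dia_imp.
  by apply: der_pr1 hbox _; hyp.
Qed.

Definition canonical_model : model Var := powerset_model canonical_rel canonical_val.

Lemma canonical_Mb : Mb canonical_model.
Proof.
apply: powerset_Mb.
(* Every classical set of worlds comes from one of the finitely many Boolean sets over the finite
   type [world]. *)
apply: (@sub_finite_set _ _ (range (fun s : {set world} => [set g | g \in s]))).
  move=> T _; exists [set g | `[< T g >]]%SET => //.
  by apply/seteqP; split=> g /=; rewrite inE => /asboolP.
exact/finite_image/finite_finset.
Qed.

(* The same team refutes all unprovable disjuncts at once, so no disjoint union
   of countermodels is needed. *)
Lemma canonical_complete D : disj D ->
  (forall A, classical A -> A \in subformulas D -> A \in S) ->
  sat (consistent : canonical_model) D -> provable D.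
Proof.
elim=> {D} [A cA|A B _ IHA _ IHB] hS.
  move=> /(sat_classical _ cA) h.
  have hSA : {subset subformulas A <= S}.
    by move=> B hB; apply: hS => //; apply: (allP (classical_subformulas cA)).
  apply: (@state_descriptions_exhaust (@provable Var) S) => //.
  - by move=> ? ? /pr_mp; apply.
  - by move=> ? ? ? ?; apply: (@der_and _ [::]).
  (* Flatness and the truth lemma cover the consistent descriptions; an inconsistent one proves
     everything. *)
  move=> g hg; have [cg|/contrapT ncg] := pselect (consistent (SeqSub hg)).
    by apply/(truth cA hSA cg)/h.
  by apply: provable_trans ncg _; apply/pr_ax/ax_bot.
case=> [hA|hB]; [apply: pr_mp (IHA _ hA) | apply: pr_mp (IHB _ hB)].
- exact/pr_ax/ax_orl.
- by move=> C cC hC; apply: hS => //=; rewrite inE mem_cat hC orbT.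
- exact/pr_ax/ax_orr.
- by move=> C cC hC; apply: hS => //=; rewrite inE mem_cat hC !orbT.
Qed.

End Canonical.

Theorem theorem3p16 (Var : Type) (phi : form Var) :
  provable phi <-> (forall M : model Var, Mb M -> forall w : M, sat w phi).
Proof.
split=> [h M MbM w|h]; first by apply/(sat_Eb MbM); apply: provable_sound h _.
have [D [dD [hD1 hD2]]] := normal_form phi.
apply: pr_mp hD2 _.
pose S := [seq A <- subformulas D | classical A].
have cS : all (@classical Var) S by apply: filter_all.
apply: (canonical_complete cS dD) => [A cA AD|].
  by rewrite mem_filter cA.
(* Soundness transfers the truth of [phi] at this team to its normal form [D]. *)
apply: (provable_sound hD1 (consistent (S := S) : canonical_model S)).
  exact: subset_refl.
exact: h (canonical_Mb S) _.
Qed.
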